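(* Let $p$ be a prime, $r\in\mathbb N$, $n_1,\ldots,n_r\in\mathbb N_0$, $\gamma_1,\ldots,\gamma_r\in\mathbb Z_p$, and $c\in\mathbb N_{>1}$ with $(c,p)=1$. Then \begin{align*} & L_{p,r}(-n_1,\ldots,-n_r;\omega^{n_1},\ldots,\omega^{n_r};\gamma_1,\ldots,\gamma_r;c) =\sum_{\substack{\xi_1^c=1\\ \xi_1\neq1}}\cdots\sum_{\substack{\xi_r^c=1\\ \xi_r\neq1}}\mathfrak B((n_j);(\xi_j);(\gamma_j))\\ &\quad+\sum_{d=1}^r\Bigl(-\frac1p\Bigr)^d\sum_{1\le i_1<\cdots<i_d\le r}\ \sum_{\rho_{i_1}^p=1}\cdots\sum_{\rho_{i_d}^p=1}\ \sum_{\substack{\xi_1^c=1\\ \xi_1\neq1}}\cdots\sum_{\substack{\xi_r^c=1\\ \xi_r\neq1}}\mathfrak B\Bigl((n_j);\bigl((\textstyle\prod_{j\le i_l}\rho_{i_l})^{\gamma_j}\xi_j\bigr);(\gamma_j)\Bigr), \end{align*} where all $\xi_j$ and $\rho_{i_l}$ run over roots of unity in $\mathbb C_p$, $\prod_{j\le i_l}\rho_{i_l}$ denotes the product over those $l\in\{1,\ldots,d\}$ with $j\le i_l$, and an empty product is $1$.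
   Context: $\mathbb N=\{1,2,\dots\}$, $\mathbb N_0=\mathbb N\cup\{0\}$; $|\cdot|_p$ is the $p$-adic absolute value on $\mathbb C_p$. Put $q=4$ if $p=2$ and $q=p$ if $p\ge3$. Let $W=\{\pm1\}$ if $p=2$ and $W=\{\xi\in\mathbb Z_p^\times:\xi^{p-1}=1\}$ if $p\ge3$. Then $\mathbb Z_p^\times=W\times(1+q\mathbb Z_p)$; write $x=\omega(x)\langle x\rangle$ accordingly ($\omega$ is the Teichmüller character), and $\omega^k(x)=\omega(x)^k$ for $k\in\mathbb Z$. For $s\in\mathbb C_p$ with $|s|_p<qp^{-1/(p-1)}$, $\langle x\rangle^{s}=\sum_{n\ge0}\binom sn(\langle x\rangle-1)^n$. For $z\in\mathbf P^1(\mathbb C_p)$ with $|z-1|_p\ge1$ let $\mathfrak m_z$ be the $p$-adic measure on $\mathbb Z_p$ with $\mathfrak m_z(j+p^N\mathbb Z_p)=\frac{z^j}{1-z^{p^N}}$ for $0\le j\le p^N-1$, and $\int_{\mathbb Z_p}f\,d\mathfrak m_z=\lim_{N\to\infty}\sum_{a=0}^{p^N-1}f(a)\mathfrak m_z(a+p^N\mathbb Z_p)$ for continuous $f:\mathbb Z_p\to\mathbb C_p$ (integrals over compact open subsets use the characteristic function; multiple integrals use product measures). For $c\in\mathbb N_{>1}$ with $(c,p)=1$ let $\widetilde{\mathfrak m}_c=\sum_{\xi\in\mathbb C_p,\ \xi^c=1,\ \xi\ne1}\mathfrak m_\xi$ (a $\mathbb Z_p$-valued measure). Let $(\mathbb Z_p^r)'_{\{\gamma_j\}}=\{(x_j)\in\mathbb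 Z_p^r: p\nmid\sum_{j=1}^{k}x_j\gamma_j\text{ for all }1\le k\le r\}$. For $k_j\in\mathbb Z$, $\gamma_j\in\mathbb Z_p$ and $s_j\in\mathbb C_p$ with $|s_j|_p<qp^{-1/(p-1)}$, the $p$-adic multiple $L$-function is $$L_{p,r}(s_1,\ldots,s_r;\omega^{k_1},\ldots,\omega^{k_r};\gamma_1,\ldots,\gamma_r;c)=\int_{(\mathbb Z_p^r)'_{\{\gamma_j\}}}\prod_{k=1}^r\Bigl\langle\sum_{j=1}^kx_j\gamma_j\Bigr\rangle^{-s_k}\omega^{k_k}\Bigl(\sum_{j=1}^kx_j\gamma_j\Bigr)\prod_{j=1}^rd\widetilde{\mathfrak m}_c(x_j)$$ (zero if the domain is empty). For $\gamma_j\in\mathbb Z_p$ and roots of unity $\xi_j\in\mathbb C_p\setminus\{1\}$, the twisted multiple Bernoulli numbers $\mathfrak B((n_j);(\xi_j);(\gamma_j))=\mathfrak B(n_1,\ldots,n_r;(\xi_j);(\gamma_j))\in\mathbb C_p$ are defined by the formal power series identity $$\prod_{j=1}^r\frac1{1-\xi_j\exp(\gamma_j\sum_{k=j}^rt_k)}=\sum_{n_1,\ldots,n_r\ge0}\mathfrak B(n_1,\ldots,n_r;(\xi_j);(\gamma_j))\frac{t_1^{n_1}}{n_1!}\cdots\frac{t_r^{n_r}}{n_r!}.$$ For $\rho^p=1$ and $\gamma\in\mathbb Z_p$, $\rho^\gamma$ means $\rho^a$ for any integer $a\equiv\gamma\pmod p$. *)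

(* Defs.v *)
From HB Require Import structures.
From mathcomp Require Import all_boot all_order all_algebra.
From mathcomp Require Import all_classical all_reals all_analysis.

Set Implicit Arguments.
Unset Strict Implicit.
Unset Printing Implicit Defensive.

Import Order.TTheory GRing.Theory Num.Theory.
Import numFieldNormedType.Exports.
Local Open Scope classical_set_scope.
Local Open Scope ring_scope.

(* The topological closure of A for the distance abs (x - y). *)
Definition abs_closure {R : realType} {C : zmodType} (abs : C -> R) (A : set C) :
    set C :=
  [set x | forall e : R, 0 < e -> exists2 y, A y & abs (x - y) < e].

(* Q_p is the completion of Q, i.e. the closure of the prime field in C_p. *)
Definition abs_Qp {R : realType} {C : fieldType} (abs : C -> R) : set C :=
  abs_closure abs (range (@ratr C)).

(* C_p is not constructed but characterised, up to isometric isomorphism, as an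
   algebraically closed field that is complete for a multiplicative ultrametric
   absolute value with |p| = 1/p and in which the elements algebraic over Q_p
   are dense.  R is the field of real numbers in which |.|_p takes its values.
   pabs is not the library norm `|x|, which on a ring takes values in the ring
   itself (numDomainType). *)
HB.mixin Record isPadicComplex (R : realType) (p : nat) C
    of GRing.ClosedField C := {
  pabs : C -> R ;
  pabs_ge0 : forall x, 0 <= pabs x ;
  pabs_eq0 : forall x, (pabs x == 0) = (x == 0) ;
  pabsM : forall x y, pabs (x * y) = pabs x * pabs y ;
  pabsD : forall x y, pabs (x + y) <= Num.max (pabs x) (pabs y) ;
  pabs_p : pabs p%:R = p%:R^-1 ;
  pabs_complete : forall u : nat -> C,
    (forall e : R, 0 < e -> exists N : nat, forall m n : nat,
       (N <= m)%N -> (N <= n)%N -> pabs (u m - u n) < e) ->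
    exists l : C, (pabs (u n - l) @[n --> \oo] --> (0 : R)) ;
  pabs_alg_dense : abs_closure pabs [set x : C | exists P : {poly C},
    [/\ P != 0, forall i, abs_Qp pabs P`_i & root P x]] = setT
}.

#[short(type="padicComplexType")]
HB.structure Definition PadicComplex (R : realType) (p : nat) :=
  {C of GRing.ClosedField C & isPadicComplex R p C}.

Section PadicIntegers.
Context {R : realType} {p : nat} {C : padicComplexType R p}.

(* The limit of u, and 0 if u diverges. *)
Definition plim (u : nat -> C) : C :=
  xget 0 [set l | (pabs (u n - l) @[n --> \oo] --> (0 : R))].

Definition padic_int : set C := [set x : C | abs_Qp pabs x /\ pabs x <= 1].

Definition padic_unit : set C :=
  [set x | [/\ padic_int x, x != 0 & padic_int x^-1]].

Definition padic_congr (q : nat) (x y : C) : Prop :=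
  exists2 u, padic_int u & x - y = q%:R * u.

Definition padic_q : nat := if p == 2 then 4 else p.

Definition padic_W : set C :=
  if p == 2 then [set 1; -1] else [set xi | padic_unit xi /\ xi ^+ p.-1 = 1].

(* For x in padic_unit, the unique w in W with x in w * (1 + q Z_p). *)
Definition teichmuller (x : C) : C :=
  xget 1 [set w | padic_W w /\
    exists2 v, padic_congr padic_q v 1 & x = w * v].

Definition diamond (x : C) : C := x / teichmuller x.

Definition gbinom (s : C) (n : nat) : C := (\prod_(i < n) (s - i%:R)) / n`!%:R.

(* <x>^s; the series converges for |s| < q p^(-1/(p-1)). *)
Definition diamond_pow (x s : C) : C :=
  plim (fun N => \sum_(0 <= n < N) gbinom s n * (diamond x - 1) ^+ n).

(* rho^gamma for rho^p = 1 and gamma in Z_p; the choice of the integer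
   a = gamma mod p is immaterial. *)
Definition padic_root_pow (rho gamma : C) : C :=
  rho ^ (xget 0 [set a : int | padic_congr p gamma a%:~R]).

End PadicIntegers.

Section PadicMeasures.
Context {R : realType} {p : nat} {C : padicComplexType R p}.

(* mu N j is the mass of the ball j + p^N Z_p, for 0 <= j < p^N. *)
Definition ball_measure := nat -> nat -> C.

Definition padic_mz (z : C) : ball_measure :=
  fun N j => z ^+ j / (1 - z ^+ (p ^ N)).

Definition nontriv_roots (c : nat) : set C := [set xi | xi ^+ c = 1 /\ xi != 1].

Definition padic_mtilde (c : nat) : ball_measure :=
  fun N j => \sum_(xi \in nontriv_roots c) padic_mz xi N j.

(* Integral over Z_p^r against the product measure mu x ... x mu. *)
Definition padic_integral (r : nat) (mu : ball_measure) (f : ('I_r -> C) -> C) : C :=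
  plim (fun N => \sum_(a : {ffun 'I_r -> 'I_(p ^ N)})
    f (fun j => (a j : nat)%:R) * \prod_(j < r) mu N (a j)).

(* The partial sum x_1 gamma_1 + ... + x_k gamma_k (indices shifted by one). *)
Definition partial_lin (r : nat) (x gamma : 'I_r -> C) (k : 'I_r) : C :=
  \sum_(j < r | (j <= k)%N) x j * gamma j.

Definition padicL_domain (r : nat) (gamma : 'I_r -> C) : set ('I_r -> C) :=
  [set x | (forall j, padic_int (x j)) /\
           forall k, ~ padic_congr p (partial_lin x gamma k) 0].

Definition padicL (r : nat) (s : 'I_r -> C) (k : 'I_r -> int) (gamma : 'I_r -> C)
    (c : nat) : C :=
  padic_integral (padic_mtilde c) (fun x => \1_(padicL_domain gamma) x *
    \prod_(i < r) (diamond_pow (partial_lin x gamma i) (- s i)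
                   * teichmuller (partial_lin x gamma i) ^ (k i))).

End PadicMeasures.

(* Formal power series in r variables, as functions from exponents to
   coefficients; note that the library's pointwise product of functions is not
   the product of series. *)
Section MultivariateSeries.
Context {C : fieldType} {r : nat}.

Definition mseries := {ffun 'I_r -> nat} -> C.

Definition ms_one : mseries := fun n => (n == 0)%:R.

Definition ms_var (k : 'I_r) : mseries :=
  fun n => (n == [ffun i => (i == k : nat)])%:R.

Definition ms_mul (f g : mseries) : mseries := fun n =>
  \sum_(ab \in [set ab : {ffun 'I_r -> nat} * {ffun 'I_r -> nat} |
                 ab.1 + ab.2 = n]) f ab.1 * g ab.2.

Definition ms_pow (f : mseries) (m : nat) : mseries := iter m (ms_mul f) ms_one.

(* exp f for f without constant term: f^m then only contributes to total degrees
   at least m, so the sum over m can be truncated at the degree of the monomial. *)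
Definition ms_exp (f : mseries) : mseries := fun n =>
  \sum_(m < (\sum_(i < r) n i)%N.+1) ms_pow f m n / m`!%:R.

(* The inverse is unique when it exists, i.e. when f has nonzero constant term. *)
Definition ms_inv (f : mseries) : mseries :=
  xget ms_one [set g : mseries | ms_mul f g = ms_one].

(* prod_j (1 - xi_j exp(gamma_j (t_j + ... + t_r)))^-1 *)
Definition bernoulli_series (xi gamma : 'I_r -> C) : mseries :=
  \big[ms_mul/ms_one]_(j < r) ms_inv (fun n =>
    ms_one n -
    xi j * ms_exp (fun n' => gamma j * \sum_(k < r | (j <= k)%N) ms_var k n') n).

(* n! times the coefficient of t^n, as the generating series is exponential. *)
Definition twisted_bernoulli (n : 'I_r -> nat) (xi gamma : 'I_r -> C) : C :=
  (\prod_(j < r) (n j)`!)%N%:R * bernoulli_series xi gamma [ffun j => n j].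

End MultivariateSeries.
Arguments mseries : clear implicits.

(* Main.v *)
(** For s_i = -n_i the integrand is, on the domain, the polynomial
    [\prod_i y_i ^+ n_i] in the partial sums y_i = x_1 gamma_1 + ... + x_i gamma_i.
    With m_i an integer congruent to y_i mod p, the indicator function of the domain
    is the product over i of [1 - p^-1 \sum_(rho^p = 1) rho^m_i]; expanding it over
    subsets i_1 < ... < i_d of the indices only multiplies the weights xi_j ^ a_j of
    the Riemann sums by p-th roots of unity to the power a_j.  It remains to evaluate
    the limit of the Riemann sums with weights eta_j ^ a_j, where eta_j^p = xi_j^p.
    Summing exp(\sum_k y_k t_k) instead of the polynomial yields a product of
    geometric sums, and the N-th sum is the product of
      (1 - eta_j exp(gamma_j T_j))^-1
    and of (1 - eta_j^M exp(M gamma_j T_j)) / (1 - xi_j^M), with M = p^N and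
    T_j = t_j + ... + t_r.  The second factors tend to 1 coefficientwise, since M
    tends to 0 and 1 - xi_j^M is a unit. *)

Require Import Defs.
From HB Require Import structures.
From mathcomp Require Import all_boot all_order all_algebra.
From mathcomp Require Import cyclic separable cyclotomic ring.
From mathcomp Require Import all_classical all_reals all_analysis.

Set Implicit Arguments.
Unset Strict Implicit.
Unset Printing Implicit Defensive.

Import Order.TTheory GRing.Theory Num.Theory.
Import numFieldNormedType.Exports.
Local Open Scope classical_set_scope.
Local Open Scope ring_scope.

(** * Sums over finite sets of arbitrary types, reindexed by finite types *)

Lemma fsbig_injective (V : nmodType) (I : finType) (T : choiceType) (P : pred I)
    (v : I -> T) (A : set T) (F : T -> V) :
  injective v -> (forall x, A x <-> exists2 i, P i & v i = x) ->
  \sum_(x \in A) F x = \sum_(i | P i) F (v i).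
Proof.
move=> v_inj AE; have -> : A = [set` map v (enum P)].
  apply/seteqP; split => x /=.
    by case/AE=> i Pi <-; apply: map_f; rewrite mem_enum.
  by case/mapP=> i; rewrite mem_enum => Pi ->; apply/AE; exists i.
by rewrite -fsbig_seq ?map_inj_uniq ?enum_uniq// big_map big_enum.
Qed.

(** Tuples of roots of unity range over a set in an infinite function type; an enumeration [v] of
    the roots makes them images of functions between finite types. *)
Lemma fsbig_ffun (V : nmodType) (D I : finType) (T : choiceType) (v : I -> T) (A : set T)
    (F : {ffun D -> T} -> V) :
  injective v -> (forall x, A x <-> exists i, v i = x) ->
  \sum_(x \in [set x : {ffun D -> T} | forall l, A (x l)]) F x =
  \sum_(e : {ffun D -> I}) F [ffun l => v (e l)].
Proof.
move=> v_inj AE; apply: (@fsbig_injective _ _ _ xpredT) => [e e' /ffunP ee'|x].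
  by apply/ffunP => l; apply: v_inj; have := ee' l; rewrite !ffunE.
split=> [xA|[e _ <-] l]; last by apply/AE; exists (e l); rewrite ffunE.
have [e eE] := choice (fun l => (AE (x l)).1 (xA l)).
by exists (finfun e) => //; apply/ffunP => l; rewrite !ffunE.
Qed.

(** * The ring of formal power series *)

Section SeriesRing.
Context {C : fieldType} {r : nat}.
Implicit Types f g h : Defs.mseries C r.

(** Exponents bounded by [N] form a finite type, so a coefficient of a product becomes an ordinary
    finite sum. *)
Definition box_val N (a : {ffun 'I_r -> 'I_N.+1}) : {ffun 'I_r -> nat} :=
  [ffun i => a i : nat].

Lemma box_val_inj N : injective (@box_val N).
Proof. by move=> a b /ffunP e; apply/ffunP=> i; apply/val_inj; have := e i; rewrite !ffunE. Qed.

Lemma box_valK N (n : {ffun 'I_r -> nat}) : (forall i, n i <= N)%N ->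
  box_val [ffun i => inord (n i) : 'I_N.+1] = n.
Proof. by move=> nN; apply/ffunP=> i; rewrite !ffunE inordK// ltnS. Qed.

Lemma ms_mul_box N f g (n : {ffun 'I_r -> nat}) : (forall i, n i <= N)%N ->
  ms_mul f g n = \sum_(a : {ffun 'I_r -> 'I_N.+1} |
       a \in family (fun i => [pred j : 'I_N.+1 | (j <= n i)%N]))
      f (box_val a) * g [ffun i => (n i - a i)%N].
Proof.
move=> nN; rewrite /ms_mul.
rewrite (@fsbig_injective _ _ _
  (mem (family (fun i => [pred j : 'I_N.+1 | (j <= n i)%N])))
  (fun a : {ffun 'I_r -> 'I_N.+1} => (box_val a, [ffun i => (n i - a i)%N])))//.
  by move=> a b [/box_val_inj].
move=> [x y]; split=> /= [xy|[a aP [<- <-]]].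
  have xyi i : n i = (x i + y i)%N by rewrite -xy ffunE.
  exists [ffun i => inord (x i)].
    apply/familyP => i; rewrite inE ffunE inordK ?xyi ?leq_addr//.
    by rewrite ltnS (leq_trans _ (nN i))// xyi leq_addr.
  congr pair; first by rewrite box_valK// => i; rewrite (leq_trans _ (nN i))// xyi leq_addr.
  apply/ffunP=> i; rewrite !ffunE inordK ?xyi ?addKn//.
  by rewrite ltnS (leq_trans _ (nN i))// xyi leq_addr.
apply/ffunP=> i; rewrite !ffunE; have /familyP/(_ i) := aP; rewrite inE => aP'.
exact: subnKC.
Qed.

(** Symmetric form of the convolution: the condition on the exponents becomes a factor 0 or 1, so
    that both sums are free and can be exchanged. *)
Lemma ms_mul_pairs N f g (n : {ffun 'I_r -> nat}) : (forall i, n i <= N)%N ->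
  ms_mul f g n = \sum_(a : {ffun 'I_r -> 'I_N.+1}) \sum_(b : {ffun 'I_r -> 'I_N.+1})
     (box_val a + box_val b == n)%:R * (f (box_val a) * g (box_val b)).
Proof.
move=> nN; rewrite /ms_mul pair_bigA /=.
rewrite (@fsbig_injective _ _ _
  (fun p => box_val p.1 + box_val p.2 == n)
  (fun p : {ffun 'I_r -> 'I_N.+1} * {ffun 'I_r -> 'I_N.+1} => (box_val p.1, box_val p.2))).
- rewrite big_mkcond; apply: eq_bigr => p _.
  by case: eqP => _ /=; rewrite ?mul1r ?mul0r.
- by move=> [a b] [a' b'] [/box_val_inj -> /box_val_inj ->].
move=> [x y]; split=> /= [xy|[[a b] /eqP <- [<- <-]]//].
have xyi i : n i = (x i + y i)%N by rewrite -xy ffunE.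
have xN i : (x i <= N)%N by rewrite (leq_trans _ (nN i))// xyi leq_addr.
have yN i : (y i <= N)%N by rewrite (leq_trans _ (nN i))// xyi leq_addl.
exists ([ffun i => inord (x i)], [ffun i => inord (y i)]); rewrite /= !box_valK//.
exact/eqP.
Qed.

Lemma le_bigmax_ffun (n : {ffun 'I_r -> nat}) i : (n i <= \max_j n j)%N.
Proof. exact: leq_bigmax. Qed.

Lemma ms_mulC : commutative (@ms_mul C r).
Proof.
move=> f g; apply/funext=> n; rewrite !(ms_mul_pairs _ _ (le_bigmax_ffun n)).
rewrite exchange_big; apply: eq_bigr => a _; apply: eq_bigr => b _.
by rewrite addrC [f _ * _]mulrC.
Qed.

(** The right-hand side treats the three factors alike; associativity then reduces to permuting
    sums. *)
Lemma ms_mul_triples N f g h (n : {ffun 'I_r -> nat}) : (forall i, n i <= N)%N ->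
  ms_mul f (ms_mul g h) n = \sum_(a : {ffun 'I_r -> 'I_N.+1})
    \sum_(b : {ffun 'I_r -> 'I_N.+1}) \sum_(c : {ffun 'I_r -> 'I_N.+1})
     (box_val a + box_val b + box_val c == n)%:R *
       (f (box_val a) * g (box_val b) * h (box_val c)).
Proof.
move=> nN; rewrite (ms_mul_pairs _ _ nN); apply: eq_bigr => a _.
have bN (b : {ffun 'I_r -> 'I_N.+1}) i : (box_val b i <= N)%N.
  by rewrite ffunE -ltnS.
under eq_bigr => b _.
  rewrite (ms_mul_pairs _ _ (bN b)) 2!big_distrr /=.
  under eq_bigr => c _ do rewrite 2!big_distrr /=.
  over.
(* With the exponents of [g] and [h] fixed, the inner sum over the exponent [b] of [ms_mul g h] has
   at most one nonzero term, where [b] is their sum. *)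
rewrite exchange_big; apply: eq_bigr => c _; rewrite exchange_big; apply: eq_bigr => d _ /=.
have [e|ne] := eqVneq (box_val a + box_val c + box_val d) n; last first.
  rewrite mul0r big1// => b _; have [ab|] := eqVneq; last by rewrite mul0r.
  have [cd|] := eqVneq; last by rewrite mul0r !mulr0.
  by move: ne; rewrite -addrA cd ab eqxx.
pose cd := box_val c + box_val d : {ffun 'I_r -> nat}.
have cdN i : (cd i <= N)%N.
  by rewrite (leq_trans _ (nN i))// -e -addrA [in leqRHS]ffunE leq_addl.
rewrite (bigD1 [ffun i => inord (cd i) : 'I_N.+1])//= box_valK//.
rewrite addrA e !eqxx !mul1r mulrA big1 ?addr0// => b bN'; rewrite -/cd.
have [ecd|] := eqVneq cd (box_val b); last by rewrite mul0r !mulr0.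
case/eqP: bN'; apply: (@box_val_inj N); rewrite box_valK//.
Qed.

Lemma ms_mulA : associative (@ms_mul C r).
Proof.
(* Commutativity brings the right-hand side to the nested form that [ms_mul_triples] expands. *)
move=> f g h; rewrite [RHS]ms_mulC; apply/funext=> n.
rewrite !(ms_mul_triples _ _ _ (le_bigmax_ffun n)) [RHS]exchange_big /=.
apply: eq_bigr => a _; rewrite [RHS]exchange_big; apply: eq_bigr => b _ /=.
apply: eq_bigr => c _; rewrite -[box_val c + _ + _]addrA addrC; congr (_ * _).
by rewrite -[RHS]mulrA [RHS]mulrC.
Qed.

Lemma ms_mul1 : left_id (@ms_one C r) (@ms_mul C r).
Proof.
move=> f; apply/funext=> n; rewrite (ms_mul_box _ _ (le_bigmax_ffun n)).
rewrite (bigD1 [ffun=> ord0])/=; last by apply/familyP => i; rewrite ffunE.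
rewrite [X in _ + X]big1 => [|a /andP[_ /eqP a0]]; last first.
  rewrite /ms_one; case: eqP => [e|_]; last by rewrite mul0r.
  case: a0; apply/ffunP => i; apply/val_inj.
  by have /ffunP/(_ i) := e; rewrite !ffunE.
rewrite addr0 /ms_one; case: eqP => [_|[]]; last by apply/ffunP => i; rewrite !ffunE.
by rewrite mul1r; congr f; apply/ffunP=> i; rewrite !ffunE subn0.
Qed.

Lemma ms_mulDl : left_distributive (@ms_mul C r) (fun f g n => f n + g n).
Proof.
move=> f g h; apply/funext=> n; rewrite !(ms_mul_box _ _ (le_bigmax_ffun n)) -big_split.
by apply: eq_bigr => a _; rewrite mulrDl.
Qed.

Lemma ms_one_neq0 : @ms_one C r != (fun=> 0).
Proof. by apply/eqP => /(congr1 (@^~ 0)) /eqP; rewrite /ms_one eqxx oner_eq0. Qed.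

End SeriesRing.

(* An alias carrying the convolution product: functions to [C] already have the
   pointwise product.  The bare name [mseries] is that of series of measures. *)
Definition fps (C : fieldType) (r : nat) : Type := Defs.mseries C r.

HB.instance Definition _ (C : fieldType) (r : nat) :=
  GRing.Zmodule.copy (fps C r) ({ffun 'I_r -> nat} -> C).
HB.instance Definition _ (C : fieldType) (r : nat) :=
  GRing.Zmodule_isComNzRing.Build (fps C r)
    (@ms_mulA C r) (@ms_mulC C r) (@ms_mul1 C r) (@ms_mulDl C r) (@ms_one_neq0 C r).

(** * Constants, inverses and exponentials of power series *)

Section SeriesTheory.
Context {C : fieldType} {r : nat}.
Implicit Types (f g h : fps C r) (x : C) (y z : 'I_r -> C) (n : {ffun 'I_r -> nat}).

Lemma fps_mul_box N f g n : (forall i, n i <= N)%N ->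
  (f * g) n = \sum_(a : {ffun 'I_r -> 'I_N.+1} |
      a \in family (fun i => [pred j : 'I_N.+1 | (j <= n i)%N]))
      f (box_val a) * g [ffun i => (n i - a i)%N].
Proof. exact: ms_mul_box. Qed.

Definition fps_const x : fps C r := fun n => x * (n == 0)%:R.

Lemma fps_constM x f n : (fps_const x * f) n = x * f n.
Proof.
rewrite -[in RHS](mul1r f) !(fps_mul_box _ _ (le_bigmax_ffun n)) big_distrr.
by apply: eq_bigr => a _; rewrite [RHS]mulrA.
Qed.

Lemma fps_const_mul x x' : fps_const (x * x') = fps_const x * fps_const x'.
Proof. by apply/funext => n; rewrite fps_constM /fps_const mulrA. Qed.

Lemma fps_const1 : fps_const 1 = 1.
Proof. by apply/funext => n; rewrite /fps_const mul1r. Qed.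

Lemma fps_const_prod (I : finType) (F : I -> C) :
  fps_const (\prod_i F i) = \prod_i fps_const (F i).
Proof. exact: (big_morph _ fps_const_mul fps_const1). Qed.

Lemma fps_constX x m : fps_const (x ^+ m) = fps_const x ^+ m.
Proof.
elim: m => [|m IH]; first exact: fps_const1.
by rewrite !exprS fps_const_mul IH.
Qed.

Lemma fps_sumE (I : Type) (s : seq I) (P : pred I) (F : I -> fps C r) n :
  (\sum_(i <- s | P i) F i) n = \sum_(i <- s | P i) F i n.
Proof. by elim/big_rec2: _ => // i u v _ <-. Qed.

Lemma fps_subE f g n : (f - g) n = f n - g n.
Proof. by []. Qed.

Lemma fps_one0 : (1 : fps C r) 0 = 1.
Proof. by rewrite [LHS]/(_%:R) eqxx. Qed.

Lemma fps_inv_ex f : f 0 != 0 -> exists g, f * g = 1.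
Proof.
move=> f0; pose c := fps_const (f 0)^-1.
pose step g := c * (1 - (f - fps_const (f 0)) * g).
pose deg n := (\sum_i n i)%N.
(* [g] inverts [f] iff it is a fixed point of [step], and [step] improves agreement
   of coefficients by one degree. *)
have stepE d g h : (forall n, deg n < d -> g n = h n)%N ->
    forall n, (deg n < d.+1 -> step g n = step h n)%N.
  move=> gh n nd; rewrite /step /c !fps_constM !fps_subE; congr (_ * (_ - _)).
  rewrite !(fps_mul_box _ _ (le_bigmax_ffun n)); apply: eq_bigr => a /familyP a_n.
  (* [f - fps_const (f 0)] has no constant term; for [a] nonzero, [g] and [h] are compared only at
     [n - a], which has smaller degree. *)
  have [a0|a0] := eqVneq (box_val a) 0.
    by rewrite a0 fps_subE /fps_const eqxx mulr1 subrr !mul0r.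
  congr (_ * _); apply: gh; rewrite /deg -ltnS (leq_trans _ nd)// ltnS.
  have [i ai] : exists i, a i != ord0.
    apply/existsP; apply: contra_neqT a0 => /existsPn a0; apply/ffunP => i.
    by have := a0 i; rewrite negbK !ffunE => /eqP ->.
  rewrite /deg (bigD1 i)//= [ltnRHS](bigD1 i)//= ffunE -addSn leq_add//.
    have := a_n i; rewrite inE => ani.
    by rewrite ltn_subrL lt0n ai (leq_trans _ ani)// lt0n.
  by apply: leq_sum => j _; rewrite ffunE leq_subr.
pose it m := iter m step 0.
have itS d : forall n, (deg n < d -> it d n = it d.+1 n)%N.
  by elim: d => [//|d IH] n; apply: stepE.
have it_stable d e n : (deg n < d -> d <= e -> it d n = it e n)%N.
  move=> nd; elim: e => [|e IH]; first by rewrite leqn0 => /eqP <-.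
  rewrite leq_eqVlt => /predU1P[<-//|de]; rewrite IH//.
  by apply: itS; exact: leq_trans nd de.
(* Diagonal choice: the coefficient at [n] is stable from iteration [deg n + 1] on. *)
pose g : fps C r := fun n => it (deg n).+1 n.
have gstep : g = step g.
  apply/funext => n; rewrite {1}/g /= -/(it _); apply: (stepE (deg n)) => // m mn.
  by rewrite /g; apply: esym; apply: it_stable.
exists g; have : fps_const (f 0) * g = 1 - (f - fps_const (f 0)) * g.
  by rewrite {1}gstep /step mulrA -fps_const_mul divff// fps_const1 mul1r.
move=> e; have -> : f * g = (f - fps_const (f 0)) * g + fps_const (f 0) * g.
  by rewrite -mulrDl subrK.
by rewrite e addrC subrK.
Qed.

Lemma ms_invP f : f 0 != 0 -> f * (ms_inv f : fps C r) = 1.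
Proof. by move=> /fps_inv_ex fg; exact: (xgetPex _ fg). Qed.

(** The series exp(y_1 t_1 + ... + y_r t_r) given by its coefficients; [ms_exp_linear] identifies it
    with [ms_exp] of the linear form. *)
Definition exp_series y : fps C r := fun n => \prod_i (y i ^+ n i / (n i)`!%:R).

Lemma exp_series_at0 y : exp_series y 0 = 1.
Proof. by rewrite /exp_series big1// => i _; rewrite ffunE expr0 fact0 divr1. Qed.

Lemma ms_varM k g n : ((ms_var k : fps C r) * g) n =
  if n k is m.+1 then g [ffun i => (n i - (i == k))%N] else 0.
Proof.
rewrite (fps_mul_box _ _ (le_bigmax_ffun n)); case nk: (n k) => [|m].
  rewrite big1// => a /familyP/(_ k); rewrite inE nk leqn0 => /eqP ak.
  rewrite /ms_var; case: eqP => [/ffunP/(_ k)|_]; last by rewrite mul0r.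
  by rewrite !ffunE ak eqxx.
have eN i : ([ffun i => (i == k : nat)] i <= \max_j n j)%N.
  rewrite ffunE; case: (i == k) => //.
  by apply: leq_trans (le_bigmax_ffun n k); rewrite nk.
have [e eE] : exists e : {ffun 'I_r -> 'I_(\max_j n j).+1},
    box_val e = [ffun i => (i == k : nat)].
  by exists [ffun i => inord ([ffun i => (i == k : nat)] i)]; exact: box_valK.
have ei i : e i = (i == k) :> nat by move/ffunP/(_ i): eE; rewrite !ffunE.
rewrite (bigD1 e)/=; last first.
  apply/familyP => i; suff : (e i <= n i)%N by [].
  by rewrite ei; case: (eqVneq i k) => // ->; rewrite nk.
rewrite [X in _ + X]big1 => [|a /andP[_ ae]]; last first.
  rewrite /ms_var -eE (inj_eq (@box_val_inj _ _)) (negbTE ae) mul0r//.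
rewrite addr0 /ms_var eE eqxx mul1r; congr g; apply/ffunP => i.
by rewrite !ffunE ei.
Qed.

Hypothesis char0 : [pchar C] =i pred0.

Let fact_neq0 m : m`!%:R != 0 :> C.
Proof. by rewrite (pcharf0P _).1// -lt0n fact_gt0. Qed.

(** The convolution sum factors over the variables, and each factor is the binomial theorem divided
    by [(n i)!]. *)
Lemma exp_seriesD y z :
  exp_series (fun i => y i + z i) = exp_series y * exp_series z.
Proof.
apply/funext => n; rewrite (fps_mul_box _ _ (le_bigmax_ffun n)) /exp_series.
set N := (\max_i n i)%N.
pose F i (j : 'I_N.+1) := (y i ^+ j / j`!%:R) * (z i ^+ (n i - j) / (n i - j)`!%:R).
transitivity (\prod_i \sum_(j : 'I_N.+1 | (j <= n i)%N) F i j); last first.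
  rewrite bigA_distr_big_dep; apply: eq_bigr => a _.
  by rewrite -big_split; apply: eq_bigr => i _; rewrite /F !ffunE.
apply: eq_bigr => i _; rewrite (big_ord_narrow_leq (le_bigmax_ffun n i)).
rewrite addrC exprDn big_distrl; apply: eq_bigr => j _; rewrite /F /=.
have jn : (j <= n i)%N by rewrite -ltnS.
rewrite -(bin_fact jn) !natrM -mulr_natr.
have : 'C(n i, j)%:R != 0 :> C by rewrite (pcharf0P _).1// -lt0n bin_gt0.
have := fact_neq0 j; have := fact_neq0 (n i - j).
move: (_ ^+ j) (_ ^+ (n i - j)) => u v.
move: (_%:R) => d0; move: (_%:R) => d1; move: (_%:R) => d2.
by move=> n0 n1 n2; field; rewrite n0 n1 n2.
Qed.

Lemma exp_series0 : exp_series (fun=> 0) = 1.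
Proof.
apply/funext => n; rewrite /exp_series [RHS]/(_%:R); case: eqP => [->|ne].
  exact: exp_series_at0.
have [i ni] : exists i, n i != 0%N.
  apply/existsP; apply: contra_notT ne => /existsPn n0; apply/ffunP => i.
  by have := n0 i; rewrite negbK ffunE => /eqP.
by rewrite (bigD1 i)//= expr0n (negbTE ni) !mul0r.
Qed.

Lemma exp_series_sum (I : Type) (s : seq I) (w : I -> 'I_r -> C) :
  exp_series (fun i => \sum_(j <- s) w j i) = \prod_(j <- s) exp_series (w j).
Proof.
elim: s => [|j s IH].
  by rewrite big_nil -exp_series0; congr exp_series; apply/funext=> i; rewrite big_nil.
rewrite big_cons -IH -exp_seriesD; congr exp_series.
by apply/funext=> i; rewrite big_cons.
Qed.

Lemma exp_seriesX y m : exp_series y ^+ m = exp_series (fun i => m%:R * y i).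
Proof.
rewrite -[in LHS](card_ord m) -prodr_const -exp_series_sum; congr exp_series.
by apply/funext=> i; rewrite sumr_const cardT size_enum_ord mulr_natl.
Qed.

Definition ms_linear y : fps C r := fun n => \sum_k y k * ms_var k n.

Lemma ms_linearM y g n : (ms_linear y * g) n =
  \sum_(k | n k != 0%N) y k * g [ffun i => (n i - (i == k))%N].
Proof.
have -> : ms_linear y = \sum_k fps_const (y k) * (ms_var k : fps C r).
  by apply/funext => m; rewrite fps_sumE; apply: eq_bigr => k _; rewrite fps_constM.
rewrite mulr_suml fps_sumE [RHS]big_mkcond; apply: eq_bigr => k _.
by rewrite -mulrA fps_constM ms_varM; case: (n k) => //=; rewrite mulr0.
Qed.

(** Multinomial theorem by induction on [m]: one more multiplication by the linear form contributes
    the factor [\sum_k n_k], which equals [m + 1] in total degree [m + 1]. *)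
Lemma ms_pow_linear y m n :
  ms_pow (ms_linear y) m n = m`!%:R * exp_series y n *+ (\sum_i n i == m)%N.
Proof.
elim: m n => [|m IH] n.
  rewrite sum_nat_eq0 /ms_pow /= /ms_one fact0 mul1r; case: eqP => [->|n0].
    rewrite exp_series_at0; case: forallP => // -[] i.
    by rewrite ffunE.
  case: forallP => // n0'; case: n0; apply/ffunP=> i.
  by have := n0' i; rewrite ffunE => /eqP.
rewrite [LHS](ms_linearM y (ms_pow (ms_linear y) m)).
(* [y k] times the exponential coefficient at [n] lowered by one in position [k] is [n k] times the
   coefficient at [n]. *)
rewrite (eq_bigr (fun k =>
    m`!%:R * exp_series y n *+ (\sum_i n i == m.+1)%N * (n k)%:R)); last first.
  move=> k nk; rewrite IH.
  have -> : (\sum_i [ffun i => (n i - (i == k))%N] i == m)%N = (\sum_i n i == m.+1)%N.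
    rewrite (bigD1 k)//= [in RHS](bigD1 k)//= ffunE eqxx -[in RHS](@prednK (n k)) ?lt0n//.
    rewrite addSn eqSS subn1; congr (_ + _ == _)%N.
    by apply: eq_bigr => i /negbTE ik; rewrite ffunE ik subn0.
  rewrite [LHS]mulrnAr [RHS]mulrnAl; congr (_ *+ _).
  rewrite mulrCA -[RHS]mulrA; congr (_ * _).
  rewrite /exp_series (bigD1 k)//= [in RHS](bigD1 k)//= ffunE eqxx.
  rewrite [X in _ * (_ * X)](eq_bigr (fun i => y i ^+ n i / (n i)`!%:R)); last first.
    by move=> i /negbTE ik; rewrite ffunE ik subn0.
  rewrite [RHS]mulrAC !mulrA; congr (_ * _).
  move: nk; case: (n k) => // l _; rewrite subSS subn0 exprS factS natrM.
  have := fact_neq0 l; have : l.+1%:R != 0 :> C by rewrite (pcharf0P _).1.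
  by move: (l.+1%:R) (l`!%:R) => u v u0 v0; field; rewrite u0 v0.
rewrite -big_distrr /=.
have -> : \sum_(i | n i != 0%N) (n i)%:R = (\sum_i n i)%:R :> C.
  rewrite natr_sum [RHS](bigID (fun i => n i == 0%N))/=.
  by rewrite [X in _ = X + _]big1 ?add0r// => i /eqP ->.
case: eqP => [->|_]; last by rewrite !mulr0n mul0r.
by rewrite !mulr1n factS natrM mulrC mulrA.
Qed.

(** Only the power equal to the total degree of [n] contributes, and it is the last term kept by the
    truncation in [ms_exp]. *)
Lemma ms_exp_linear y : ms_exp (ms_linear y) = exp_series y.
Proof.
apply/funext => n; rewrite /ms_exp big_ord_recr /= big1 => [|m _].
  by rewrite add0r ms_pow_linear eqxx mulrAC divff// mul1r.
by rewrite ms_pow_linear gtn_eqF// mulr0n mul0r.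
Qed.

(** [gamma j *+ (j <= i)%N] is the coefficient of t_i in gamma_j (t_j + ... + t_r). *)
Lemma twisted_bernoulliE (k : 'I_r -> nat) (xi gamma : 'I_r -> C) :
  twisted_bernoulli k xi gamma = (\prod_j (k j)`!)%N%:R *
    (\prod_j (ms_inv (1 - fps_const (xi j) *
       exp_series (fun i => gamma j *+ (j <= i)%N)) : fps C r)) [ffun j => k j].
Proof.
congr (_ * _); rewrite /bernoulli_series.
apply: (congr1 (fun f : fps C r => f [ffun j => k j])).
apply: eq_bigr => j _; congr ms_inv; apply/funext => n.
rewrite fps_subE fps_constM -ms_exp_linear; congr (_ - _ * _).
congr (ms_exp _ _); apply/funext=> m; rewrite /ms_linear big_distrr big_mkcond.
by apply: eq_bigr => i _; case: leqP => _ /=; rewrite ?mulr1n ?mulr0n ?mul0r.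
Qed.

(** The sum over [a] factors into geometric sums with ratio [e j], and [1 - e j] is invertible
    because its constant term is [1 - eta j]. *)
Lemma geometric_exp_series (M : nat) (eta gamma : 'I_r -> C) n :
  (forall j, eta j != 1) ->
  \sum_(a : {ffun 'I_r -> 'I_M}) (\prod_j eta j ^+ a j) *
     exp_series (fun k => \sum_(j < r | (j <= k)%N) (a j)%:R * gamma j) n =
  (\prod_j ((ms_inv (1 - fps_const (eta j) *
       exp_series (fun i => gamma j *+ (j <= i)%N)) : fps C r) *
    (1 - fps_const (eta j ^+ M) *
       exp_series (fun i => M%:R * (gamma j *+ (j <= i)%N))))) n.
Proof.
move=> eta1; pose e j := fps_const (eta j) * exp_series (fun i => gamma j *+ (j <= i)%N).
transitivity ((\prod_j \sum_(a < M) e j ^+ a) n).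
  rewrite bigA_distr_bigA fps_sumE; apply: eq_bigr => a _.
  rewrite -fps_constM fps_const_prod -/(exp_series _).
  (* The sum of the y_k t_k is regrouped by [j]: each [a j] multiplies gamma_j (t_j + ... + t_r). *)
  have -> : exp_series (fun k => \sum_(j < r | (j <= k)%N) (a j)%:R * gamma j) =
      \prod_j exp_series (fun i => (a j)%:R * (gamma j *+ (j <= i)%N)).
    rewrite -exp_series_sum; congr exp_series; apply/funext=> k.
    rewrite big_mkcond; apply: eq_bigr => j _.
    by case: leqP; rewrite ?mulr1n// mulr0n mulr0.
  rewrite -big_split; congr (_ n); apply: eq_bigr => j _ /=.
  by rewrite exprMn fps_constX exp_seriesX.
congr (_ n); apply: eq_bigr => j _; rewrite -exp_seriesX fps_constX -exprMn -/(e j).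
have ej : (1 - e j) 0 != 0.
  by rewrite fps_subE /e fps_constM exp_series_at0 fps_one0 mulr1 subr_eq0 eq_sym.
have -> : 1 - e j ^+ M = (1 - e j) * \sum_(a < M) e j ^+ a.
  by rewrite -opprB subrX1 -mulNr opprB.
rewrite mulrA.
by rewrite -/(e j) [_ * (1 - e j)]mulrC ms_invP// mul1r.
Qed.

End SeriesTheory.

(** * Arithmetic of C_p *)

Section PadicAbs.
Context {R : realType} {p : nat} {C : padicComplexType R p}.
Hypothesis p_prime : prime p.
Local Notation abs := (@pabs R p C).

Let p_gt0 : (0 < p)%N := prime_gt0 p_prime.
Let p_gt1 : (1 < p)%N := prime_gt1 p_prime.

Lemma pabs0 : abs 0 = 0.
Proof. by apply/eqP; rewrite pabs_eq0. Qed.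

Lemma pabs1 : abs 1 = 1.
Proof.
have n1 : abs 1 != 0 by rewrite pabs_eq0 oner_eq0.
by apply: (mulfI n1); rewrite -pabsM !mulr1.
Qed.

Lemma pabsX x n : abs (x ^+ n) = abs x ^+ n.
Proof. by elim: n => [|n IH]; rewrite ?expr0 ?pabs1// !exprS pabsM IH. Qed.

Lemma pabsN x : abs (- x) = abs x.
Proof.
rewrite -mulN1r pabsM -[RHS]mul1r; congr (_ * _).
by apply/eqP; rewrite -(@eqrXn2 _ 2)// ?pabs_ge0// -pabsX sqrrN expr1n pabs1 expr1n.
Qed.

Lemma pabsV x : abs x^-1 = (abs x)^-1.
Proof.
have [->|x0] := eqVneq x 0; first by rewrite invr0 pabs0 invr0.
have ax : abs x != 0 by rewrite pabs_eq0.
by apply: (mulfI ax); rewrite -pabsM !divff// pabs1.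
Qed.

Lemma pabsB x y : abs (x - y) <= Num.max (abs x) (abs y).
Proof. by rewrite -(pabsN y) pabsD. Qed.

Lemma pabs_distC x y : abs (x - y) = abs (y - x).
Proof. by rewrite -opprB pabsN. Qed.

Lemma pabs_triangle x y : abs (x + y) <= abs x + abs y.
Proof.
apply: le_trans (pabsD x y) _.
by rewrite ge_max lerDl lerDr !pabs_ge0.
Qed.

Lemma pabs_nat_le1 n : abs n%:R <= 1.
Proof.
elim: n => [|n IH]; first by rewrite pabs0.
by rewrite -natr1 (le_trans (pabsD _ _))// ge_max IH pabs1 lexx.
Qed.

Lemma pabs_intE (z : int) : abs z%:~R = abs `|z|%N%:R.
Proof. by case: z => n; rewrite // NegzE mulrNz pabsN. Qed.

Lemma pabs_int_le1 (z : int) : abs z%:~R <= 1.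
Proof. by rewrite pabs_intE pabs_nat_le1. Qed.

Lemma pabs_p_lt1 : abs p%:R < 1.
Proof. by rewrite pabs_p invf_lt1 ?ltr1n ?ltr0n. Qed.

(** By Euler's theorem a power of [m] differs from 1 by a multiple of [p]; if [m] had absolute value
    below 1, so would 1. *)
Lemma pabs_coprime m : coprime m p -> abs m%:R = 1.
Proof.
move=> mp; apply/eqP; rewrite eq_le pabs_nat_le1 /= leNgt; apply/negP => m1.
have /eqP := Euler_exp_totient mp; rewrite [X in _ == X]modn_small// => /eqP mE.
have : (1 : C) = m%:R ^+ totient p - (m ^ totient p %/ p)%:R * p%:R.
  by rewrite -natrX {1}(divn_eq (m ^ totient p) p) mE natrD natrM addrAC subrr add0r.
move=> /(congr1 abs); rewrite pabs1 => e1.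
have := pabsB (m%:R ^+ totient p) ((m ^ totient p %/ p)%:R * p%:R).
rewrite -e1 le_max pabsX pabsM => /orP[].
  by apply/negP; rewrite -ltNge exprn_ilt1 ?pabs_ge0// -lt0n totient_gt0.
apply/negP; rewrite -ltNge (le_lt_trans _ pabs_p_lt1)//.
by rewrite ler_piMl ?pabs_ge0 ?pabs_nat_le1.
Qed.

Lemma padic_char0 : [pchar C] =i pred0.
Proof.
move=> q; rewrite inE; apply/negbTE/negP => /andP[q_prime q0].
have [qp|qp] := eqVneq q p.
  by move: q0; rewrite qp -pabs_eq0 pabs_p invr_eq0 pnatr_eq0 gtn_eqF.
have : coprime q p by rewrite prime_coprime// dvdn_prime2.
by move=> /pabs_coprime; rewrite (eqP q0) pabs0 => /esym/eqP; rewrite oner_eq0.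
Qed.

Lemma padic_natr_eq0 n : (n%:R == 0 :> C) = (n == 0%N).
Proof. exact: (pcharf0P C).1 padic_char0 n. Qed.

Lemma padic_intr_eq0 (z : int) : (z%:~R == 0 :> C) = (z == 0).
Proof. by rewrite -pabs_eq0 pabs_intE pabs_eq0 padic_natr_eq0 absz_eq0. Qed.

Lemma pabs_lt1_dvdz (z : int) : (abs z%:~R < 1) = (p %| z)%Z.
Proof.
rewrite pabs_intE dvdzE /=; case: (boolP (p %| _)%N) => [/dvdnP[k ->]|pz].
  by rewrite natrM pabsM (le_lt_trans _ pabs_p_lt1)// ler_piMl ?pabs_ge0 ?pabs_nat_le1.
by rewrite pabs_coprime ?ltxx// coprime_sym prime_coprime.
Qed.

(** * The closure of the rationals, p-adic integers and their residues *)

Lemma ratr_frac (a b : int) : b != 0 -> ratr (a%:~R / b%:~R) = a%:~R / b%:~R :> C.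
Proof.
move=> b0; set x := _ / _.
have bQ : b%:~R != 0 :> rat by rewrite intr_eq0.
have e : numq x * b = a * denq x.
  apply: (@intr_inj rat); rewrite !intrM numqE mulrAC [x * _]divfK//.
rewrite /ratr; apply/eqP; rewrite eqr_div ?padic_intr_eq0 ?denq_neq0//.
by rewrite -!intrM e.
Qed.

Lemma range_ratrP (x : C) : range ratr x <->
  exists a b : int, b != 0 /\ x = a%:~R / b%:~R.
Proof.
split=> [[y _ <-]|[a [b [b0 ->]]]]; last by exists (a%:~R / b%:~R) => //; rewrite ratr_frac.
by exists (numq y), (denq y); split => //; exact: denq_neq0.
Qed.

Lemma abs_QpD (x y : C) : abs_Qp abs x -> abs_Qp abs y -> abs_Qp abs (x + y).
Proof.
move=> xQ yQ e e0; have [x' x'Q xx'] := xQ e e0; have [y' y'Q yy'] := yQ e e0.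
exists (x' + y').
  have [a [b [b0 ->]]] := (range_ratrP x').1 x'Q.
  have [c [d [d0 ->]]] := (range_ratrP y').1 y'Q.
  apply/range_ratrP; exists (a * d + c * b), (b * d); split; first by rewrite mulf_neq0.
  by rewrite addf_div ?padic_intr_eq0// !intrD !intrM.
by rewrite opprD addrACA (le_lt_trans (pabsD _ _))// gt_max xx' yy'.
Qed.

Lemma abs_Qp_int (z : int) : abs_Qp abs (z%:~R : C).
Proof.
move=> e e0; exists z%:~R; last by rewrite subrr pabs0.
by apply/range_ratrP; exists z, 1; rewrite divr1.
Qed.

(** Division by [p] multiplies distances by [p], so [x] is approximated within [e / p]. *)
Lemma abs_Qp_divp (x : C) : abs_Qp abs x -> abs_Qp abs (x / p%:R).
Proof.
move=> xQ e e0; have [|y yQ xy] := xQ (e / p%:R); first by rewrite divr_gt0 ?ltr0n.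
exists (y / p%:R).
  have [a [b [b0 ->]]] := (range_ratrP y).1 yQ.
  apply/range_ratrP; exists a, (b * p%:Z); split.
    by rewrite mulf_neq0// -lt0n.
  by rewrite intrM invfM mulrA.
rewrite -mulrBl pabsM pabsV pabs_p invrK.
by rewrite -ltr_pdivlMr ?ltr0n.
Qed.

Lemma padic_intD (x y : C) : padic_int x -> padic_int y -> padic_int (x + y).
Proof.
move=> [xQ x1] [yQ y1]; split; first exact: abs_QpD.
by rewrite (le_trans (pabsD _ _))// ge_max x1.
Qed.

Lemma padic_int_intr (z : int) : padic_int (z%:~R : C).
Proof. by split; [exact: abs_Qp_int|exact: pabs_int_le1]. Qed.

Lemma padic_congr0 q : @padic_congr R p C q 0 0.
Proof. by exists 0; [exact: (padic_int_intr 0)|rewrite mulr0 subr0]. Qed.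

Lemma padic_congrD q (x x' y y' : C) : padic_congr q x x' -> padic_congr q y y' ->
  padic_congr q (x + y) (x' + y').
Proof.
move=> [u uZ e] [v vZ e']; exists (u + v); first exact: padic_intD.
by rewrite opprD addrACA e e' mulrDr.
Qed.

Lemma padic_congr_natM q n (x x' : C) : padic_congr q x x' ->
  padic_congr q (n%:R * x) (n%:R * x').
Proof.
move=> xx'; elim: n => [|n IH]; first by rewrite !mul0r; exact: padic_congr0.
by rewrite -natr1 !mulrDl !mul1r; exact: padic_congrD.
Qed.

Lemma padic_congr_sum q (I : Type) (s : seq I) (P : pred I) (F G : I -> C) :
  (forall i, padic_congr q (F i) (G i)) ->
  padic_congr q (\sum_(i <- s | P i) F i) (\sum_(i <- s | P i) G i).
Proof.
move=> FG; elim/big_rec2: _ => [|i x y _ xy]; first exact: padic_congr0.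
exact: padic_congrD.
Qed.

(** [y] and [m] differ by [p] times an integral element, and for an integer, absolute value below 1
    means divisibility by [p]. *)
Lemma padic_congr_intr (y : C) (m : int) : padic_congr p y m%:~R ->
  padic_congr p y 0 <-> (p %| m)%Z.
Proof.
move=> [v [vQ v1] yE]; split=> [[u [uQ u1]]|/dvdzP[k mE]].
  rewrite subr0 => yE'; rewrite -pabs_lt1_dvdz.
  have -> : m%:~R = p%:R * (u - v) :> C by rewrite mulrBr -yE -yE' subKr.
  rewrite pabsM (le_lt_trans _ pabs_p_lt1)// ler_piMr ?pabs_ge0//.
  by rewrite (le_trans (pabsB _ _))// ge_max u1.
exists (v + k%:~R); first by apply: padic_intD; [|exact: padic_int_intr].
by rewrite mulrDr -yE mE intrM mulrC subr0 [p%:R * _]mulrC subrK.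
Qed.

(** A rational [t] within [1 / p] of [x] has absolute value at most 1, hence a denominator prime to
    [p]; the residue is the numerator times an inverse of the denominator mod [p]. *)
Lemma padic_int_residue (x : C) : padic_int x ->
  exists a : int, padic_congr p x a%:~R.
Proof.
move=> [xQ x1].
have [|y [t _ <-{y}] xt] := xQ (p%:R^-1); first by rewrite invr_gt0 ltr0n.
have pd : coprime `|denq t| p.
  rewrite coprime_sym prime_coprime//; apply/negP => pd.
  have pn : ~~ (p %| `|numq t|)%N.
    apply/negP => pn; have := coprime_num_den t; rewrite /coprime => /eqP g1.
    have : (p %| gcdn `|numq t| `|denq t|)%N by rewrite dvdn_gcd pn.
    by rewrite g1 dvdn1 gtn_eqF.
  have t1 : abs (ratr t) <= 1.
    rewrite -[ratr t](subKr x) (le_trans (pabsB _ _))// ge_max x1 /=.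
    by rewrite (le_trans (ltW xt))// invf_le1 ?ler1n ?ltr0n.
  move: t1; apply/negP; rewrite -ltNge /ratr pabsM pabsV.
  rewrite pabs_intE pabs_coprime; last by rewrite coprime_sym prime_coprime.
  rewrite mul1r invf_gt1 ?pabs_lt1_dvdz//.
  by rewrite lt_neqAle pabs_ge0 eq_sym pabs_eq0 padic_intr_eq0 denq_neq0.
have d1 : abs (denq t)%:~R = 1 by rewrite pabs_intE pabs_coprime.
have /coprimezP[[u v] /= uv] : coprimez (denq t) p by rewrite /coprimez.
exists (numq t * u), ((x - (numq t * u)%:~R) / p%:R); last first.
  by rewrite [RHS]mulrC divfK// padic_natr_eq0 -lt0n.
split.
  by apply/abs_Qp_divp/abs_QpD => //; rewrite -mulrNz; exact: abs_Qp_int.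
rewrite pabsM pabsV pabs_p invrK -ler_pdivlMr ?ltr0n// div1r.
(* From [u * denq t + v * p = 1]; both summands have absolute value at most [1 / p]. *)
have -> : x - (numq t * u)%:~R = (x - ratr t) + ratr t * v%:~R * p%:R.
  have vp : v%:~R * p%:R = 1 - u%:~R * (denq t)%:~R :> C.
    have -> : v%:~R * p%:R = (v * p)%:~R :> C by rewrite intrM.
    by rewrite (_ : v * p = 1 - u * denq t) ?intrB ?intrM// -uv addrAC subrr add0r.
  have td : ratr t * (denq t)%:~R = (numq t)%:~R :> C.
    by rewrite /ratr divfK// padic_intr_eq0 denq_neq0.
  by rewrite -mulrA vp mulrBr mulr1 mulrCA td addrA subrK intrM [_ * u%:~R]mulrC.
rewrite (le_trans (pabsD _ _))// ge_max (ltW xt) /= !pabsM pabs_p.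
rewrite ler_piMl ?invr_ge0 ?ler0n// pabsV d1 invr1 mulr1.
by rewrite mulr_ile1 ?pabs_ge0 ?pabs_int_le1.
Qed.

(** The same choice of integer as in [padic_root_pow], so that [padic_root_pow rho gamma] is
    [rho ^ residue gamma] by definition. *)
Definition residue (x : C) : int := xget 0 [set a : int | padic_congr p x a%:~R].

Lemma residueP (x : C) : padic_int x -> padic_congr p x (residue x)%:~R.
Proof. by move=> /padic_int_residue xa; exact: (@xgetPex _ 0 [set a : int | _] xa). Qed.

(** Turns the condition defining the domain, at points with natural coordinates, into divisibility
    of an integer. *)
Lemma padic_congr_lin_residue (I : finType) (P : pred I) (a : I -> nat) (x : I -> C) :
  (forall i, padic_int (x i)) ->
  padic_congr p (\sum_(i | P i) (a i)%:R * x i) 0 <->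
  (p %| \sum_(i | P i) (a i)%:Z * residue (x i))%Z.
Proof.
move=> xZ; apply: padic_congr_intr; rewrite rmorph_sum /=.
apply: padic_congr_sum => i; rewrite intrM.
by apply: padic_congr_natM; exact: residueP.
Qed.

(** * The p-th roots of unity *)

Lemma padic_prim_root : exists w : C, p.-primitive_root w.
Proof.
have [s sE] := closed_field_poly_normal ('X^p - 1 : {poly C}).
have Xp : 'X^p - 1 \is @monic C by rewrite -polyC1 monicXnsubC.
rewrite (monicP Xp) scale1r in sE.
have s_uniq : uniq s.
  by rewrite -separable_prod_XsubC -sE separable_Xn_sub_1// padic_natr_eq0 -lt0n.
have s_root : all p.-unity_root s.
  by apply/allP => x xs; rewrite unity_rootE -root_prod_XsubC -sE in xs *;
    rewrite /root hornerD hornerXn hornerN hornerC subr_eq0 in xs.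
have ps : (p <= size s)%N.
  by rewrite -ltnS -(size_prod_XsubC s id) -sE -[1]/(1%:P) size_XnsubC.
by have /hasP[w _ wp] := has_prim_root p_gt0 s_root s_uniq ps; exists w.
Qed.

(** Orthogonality of the characters of Z/p: the sum is geometric with ratio [w ^ m], a p-th root of
    unity. *)
Lemma sum_prim_root_expz (w : C) (m : int) : p.-primitive_root w ->
  \sum_(i < p) (w ^+ i) ^ m = if (p %| m)%Z then p%:R else 0.
Proof.
move=> wp; have z1 : (w ^ m == 1) = (p %| m)%Z.
  rewrite dvdzE /=; case: m => n; first by rewrite -exprnP (prim_order_dvd wp).
  by rewrite NegzE -exprnN invr_eq1 -(prim_order_dvd wp) abszN.
rewrite (eq_bigr (fun i : 'I_p => (w ^ m) ^+ i)); last first.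
  by move=> i _; rewrite !exprnP exprzAC.
rewrite -z1; case: (eqVneq (w ^ m) 1) => [->|zn1].
  by rewrite (eq_bigr (fun=> 1)) ?sumr_const ?card_ord// => i _; rewrite expr1n.
have : (w ^ m - 1) * \sum_(i < p) (w ^ m) ^+ i = 0.
  by rewrite -subrX1 exprnP exprzAC -exprnP (prim_expr_order wp) exp1rz subrr.
by move/eqP; rewrite mulf_eq0 subr_eq0 (negbTE zn1) => /eqP.
Qed.

End PadicAbs.

(** * Limits in C_p *)

Section PadicLimits.
Context {R : realType} {p : nat} {C : padicComplexType R p}.
Hypothesis p_prime : prime p.
Local Notation abs := (@pabs R p C).

(** The predicate whose witness [plim] selects. *)
Definition tends_to (u : nat -> C) (l : C) :=
  abs (u n - l) @[n --> \oo] --> (0 : R).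

Lemma tends_to_bound (b : nat -> R) u l :
  (forall n, abs (u n - l) <= b n) -> b n @[n --> \oo] --> (0 : R) -> tends_to u l.
Proof.
move=> ub b0; apply: (@squeeze_cvgr _ _ _ _ (fun=> 0) b) => //; last exact: cvg_cst.
by apply: nearW => n; rewrite pabs_ge0 ub.
Qed.

Lemma tends_to_unique u l l' : tends_to u l -> tends_to u l' -> l = l'.
Proof.
move=> ul ul'; have s0 : abs (u n - l) + abs (u n - l') @[n --> \oo] --> (0 : R).
  by rewrite -[0]addr0; exact: cvgD.
have c0 : abs (l - l') @[n --> \oo] --> (0 : R).
  apply: (@squeeze_cvgr _ _ _ _ (fun=> 0) _ _ _ _ _ s0); last exact: cvg_cst.
  apply: nearW => n; rewrite pabs_ge0 /= (pabs_distC _ l).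
  apply: le_trans (pabs_triangle _ _); rewrite addrA subrK//.
have : abs (l - l') = 0 by rewrite -(cvg_lim _ c0)// lim_cst.
by move/eqP; rewrite pabs_eq0 subr_eq0 => /eqP.
Qed.

Lemma tends_to_cst l : tends_to (fun=> l) l.
Proof. by rewrite /tends_to subrr pabs0; exact: cvg_cst. Qed.

Lemma tends_to_near u v l : (\forall n \near \oo, u n = v n) -> tends_to u l -> tends_to v l.
Proof.
move=> uv; apply: cvg_trans; apply: near_eq_cvg.
by near=> n; rewrite (near uv n).
Unshelve. all: by end_near. Qed.

Lemma tends_toD u v l m : tends_to u l -> tends_to v m ->
  tends_to (fun n => u n + v n) (l + m).
Proof.
move=> ul vm; apply: (@tends_to_bound (fun n => abs (u n - l) + abs (v n - m))).
  by move=> n; rewrite opprD addrACA pabs_triangle.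
by rewrite -[0]addr0; exact: cvgD.
Qed.

Lemma tends_toM u v l m : tends_to u l -> tends_to v m ->
  tends_to (fun n => u n * v n) (l * m).
Proof.
move=> ul vm; apply: (@tends_to_bound (fun n => abs (u n - l) * abs (v n - m) +
  (abs (u n - l) * abs m + abs l * abs (v n - m)))).
  move=> n; have -> : u n * v n - l * m =
    (u n - l) * (v n - m) + ((u n - l) * m + l * (v n - m)) by ring.
  rewrite (le_trans (pabs_triangle _ _))// pabsM lerD2l.
  by rewrite (le_trans (pabs_triangle _ _))// !pabsM.
have -> : 0 = 0 * 0 + (0 * abs m + abs l * 0) :> R by rewrite !mul0r mulr0 !addr0.
apply: cvgD; first exact: cvgM.
by apply: cvgD; apply: cvgM => //; exact: cvg_cst.
Qed.

Lemma tends_to_sum (I : Type) (s : seq I) (P : pred I) (u : I -> nat -> C) (l : I -> C) :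
  (forall i, tends_to (u i) (l i)) ->
  tends_to (fun n => \sum_(i <- s | P i) u i n) (\sum_(i <- s | P i) l i).
Proof.
move=> ul; elim: s => [|i s IH].
  by rewrite big_nil; under eq_fun do rewrite big_nil; exact: tends_to_cst.
rewrite big_cons; under eq_fun do rewrite big_cons.
by case: (P i) => //; exact: tends_toD.
Qed.

Lemma plimE u l : tends_to u l -> plim u = l.
Proof.
move=> ul; apply: xget_unique => // l' ul'.
exact: tends_to_unique ul' ul.
Qed.

Lemma tends_to_expp : tends_to (fun N => (p ^ N)%:R) 0.
Proof.
apply: (@tends_to_bound (fun N => p%:R^-1 ^+ N)).
  by move=> N; rewrite subr0 natrX pabsX pabs_p.
apply: cvg_expr; rewrite ger0_norm ?invr_ge0 ?ler0n//.
by rewrite -(@pabs_p R p C) pabs_p_lt1.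
Qed.

(** * Coefficientwise convergence of power series *)

Section Coefficients.
Context {r : nat}.

Definition fps_tends_to (F : nat -> fps C r) (f : fps C r) :=
  forall n, tends_to (fun N => F N n) (f n).

Lemma fps_tends_toM F G f g : fps_tends_to F f -> fps_tends_to G g ->
  fps_tends_to (fun N => F N * G N) (f * g).
Proof.
move=> Ff Gg n; rewrite (fps_mul_box _ _ (le_bigmax_ffun n)).
under eq_fun do rewrite (fps_mul_box _ _ (le_bigmax_ffun n)).
by apply: tends_to_sum => a; exact: tends_toM.
Qed.

Lemma fps_tends_to_prod (I : Type) (s : seq I) (F : I -> nat -> fps C r) (f : I -> fps C r) :
  (forall i, fps_tends_to (F i) (f i)) ->
  fps_tends_to (fun n => \prod_(i <- s) F i n) (\prod_(i <- s) f i).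
Proof.
move=> ul; elim: s => [|i s IH].
  by rewrite big_nil; under eq_fun do rewrite big_nil; move=> n; exact: tends_to_cst.
by rewrite big_cons; under eq_fun do rewrite big_cons; exact: fps_tends_toM.
Qed.

Lemma exp_series_scale x (y : 'I_r -> C) n :
  exp_series (fun i => x * y i) n = x ^+ (\sum_i n i) * exp_series y n.
Proof.
rewrite /exp_series -prodrXr -big_split; apply: eq_bigr => i _ /=.
by rewrite exprMn mulrA.
Qed.

(** Reads the monomial in the [y i], which is the form of the integrand, off the generating
    series. *)
Lemma exp_series_ffun (y : 'I_r -> C) (k : 'I_r -> nat) :
  exp_series y [ffun j => k j] = (\prod_i y i ^+ k i) / \prod_i (k i)`!%:R.
Proof.
by rewrite -prodfV -big_split; apply: eq_bigr => i _; rewrite /= ffunE.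
Qed.

Lemma tends_to_exp_expp (y : 'I_r -> C) n : n != 0 ->
  tends_to (fun N => exp_series (fun i => (p ^ N)%:R * y i) n) 0.
Proof.
move=> n0; under eq_fun do rewrite exp_series_scale.
rewrite -(mul0r (exp_series y n)); apply: tends_toM; last exact: tends_to_cst.
have : (0 < \sum_i n i)%N.
  rewrite lt0n; apply: contra_neqN n0; rewrite sum_nat_eq0 => /forallP n0.
  by apply/ffunP => i; have := n0 i; rewrite ffunE => /eqP.
case: (\sum_i n i)%N => // d _; under eq_fun do rewrite exprS.
(* One factor [p ^ N] tends to 0; the other [d] have absolute value at most 1. *)
apply: (@tends_to_bound (fun N => abs ((p ^ N)%:R - 0))); last exact: tends_to_expp.
move=> N; rewrite !subr0 pabsM ler_piMr ?pabs_ge0//.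
by rewrite pabsX exprn_ile1 ?pabs_ge0 ?pabs_nat_le1.
Qed.

End Coefficients.

(** * Roots of unity of order prime to p, and the limit of the twisted Riemann sums *)

Lemma root1_expp_neq1 c (xi : C) N : (0 < c)%N -> coprime c p ->
  nontriv_roots c xi -> xi ^+ (p ^ N) != 1.
Proof.
move=> c0 cp [xic xi1]; apply: contra_neq xi1 => xiN.
have : coprime c (p ^ N) by rewrite coprimeXr.
case/(coprimeP _ c0) => -[u v] /= uv.
have : xi ^+ (u * c) = xi ^+ (v * p ^ N + 1)%N by rewrite -uv subnKC// ltnW// -subn_gt0 uv.
by rewrite exprD expr1 mulnC exprM xic mulnC exprM xiN !expr1n mul1r => <-.
Qed.

Lemma nontriv_roots_exp c (xi : C) N : (0 < c)%N -> coprime c p ->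
  nontriv_roots c xi -> nontriv_roots c (xi ^+ (p ^ N)).
Proof.
by move=> c0 cp xic; split; [rewrite exprAC xic.1 expr1n|exact: root1_expp_neq1 xic].
Qed.

(** The derivative of the geometric sum, cleared of denominators. For a nontrivial c-th root of
    unity and [n = c] the right-hand side vanishes. *)
Lemma weighted_geometric_sum (A : comPzRingType) (z : A) n :
  (1 - z) * (\sum_(i < n) i%:R * z ^+ i) + n%:R * z ^+ n = z * \sum_(i < n) z ^+ i.
Proof.
elim: n => [|n IH]; first by rewrite !big_ord0 !mulr0 mul0r addr0.
rewrite !big_ord_recr /= !mulrDr -IH exprS -natr1; ring.
Qed.

Lemma pabs_root1 c (z : C) : (0 < c)%N -> z ^+ c = 1 -> abs z = 1.
Proof.
move=> c0 zc; apply/eqP; rewrite -(@pexpr_eq1 _ _ c) ?pabs_ge0//.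
by rewrite -pabsX zc pabs1.
Qed.

Lemma pabs_sum_le1 (I : Type) (s : seq I) (F : I -> C) :
  (forall i, abs (F i) <= 1) -> abs (\sum_(i <- s) F i) <= 1.
Proof.
move=> F1; elim/big_rec: _ => [|i x _ x1]; first by rewrite pabs0.
by rewrite (le_trans (pabsD _ _))// ge_max F1.
Qed.

(* The product of [1 - z] with the integral element [\sum_i i z^i] is [- c],
   which has absolute value 1. *)
Lemma pabs_one_sub_root c (z : C) : (0 < c)%N -> coprime c p ->
  nontriv_roots c z -> abs (1 - z) = 1.
Proof.
move=> c0 cp [zc z1]; have az := pabs_root1 c0 zc.
have s0 : \sum_(i < c) z ^+ i = 0.
  have /eqP := subrX1 z c; rewrite zc subrr eq_sym mulf_eq0 subr_eq0.
  by rewrite (negbTE z1) => /eqP.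
have /eqP := weighted_geometric_sum z c; rewrite s0 mulr0 zc mulr1 addr_eq0 => /eqP.
move=> /(congr1 abs); rewrite pabsN pabs_coprime// pabsM => e.
apply/eqP; rewrite eq_le; apply/andP; split.
  by rewrite (le_trans (pabsB _ _))// pabs1 az ge_max lexx.
rewrite -{1}e ler_piMr ?pabs_ge0//; apply: pabs_sum_le1 => i.
by rewrite pabsM pabsX az expr1n mulr1 pabs_nat_le1.
Qed.

(** By [geometric_exp_series] the N-th sum is, up to factorials, the coefficient at [k] of the
    product of the [B j * G N j]. The hypothesis on [eta j ^+ p] makes the constant term of [G N j]
    equal to 1 for positive [N]. *)
Lemma tends_to_twisted_bernoulli r c (k : 'I_r -> nat) (gamma eta xi : 'I_r -> C) :
  (0 < c)%N -> coprime c p -> (forall j, nontriv_roots c (xi j)) ->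
  (forall j, eta j ^+ p = xi j ^+ p) ->
  tends_to (fun N => \sum_(a : {ffun 'I_r -> 'I_(p ^ N)})
      (\prod_(i < r) (\sum_(j < r | (j <= i)%N) (a j)%:R * gamma j) ^+ k i) *
      \prod_j (eta j ^+ a j / (1 - xi j ^+ (p ^ N))))
    (twisted_bernoulli k eta gamma).
Proof.
move=> c0 cp xic etap; have char0 := padic_char0 p_prime (C := C).
have etaX N j : eta j ^+ (p ^ N.+1) = xi j ^+ (p ^ N.+1).
  by rewrite expnS !exprM etap.
have eta1 j : eta j != 1.
  have := root1_expp_neq1 1 c0 cp (xic j); rewrite -(etaX 0%N).
  by apply: contra_neq => ->; rewrite expr1n.
have aeta j : abs (eta j) = 1.
  apply: (@pabs_root1 (p * c)%N); first by rewrite muln_gt0 prime_gt0.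
  by rewrite exprM etap exprAC (xic j).1 expr1n.
rewrite twisted_bernoulliE//.
pose y j i := gamma j *+ (j <= i)%N.
pose B j : fps C r := ms_inv (1 - fps_const (eta j) * exp_series (y j)).
pose G N j : fps C r := fps_const (1 - xi j ^+ (p ^ N))^-1 *
  (1 - fps_const (eta j ^+ (p ^ N)) * exp_series (fun i => (p ^ N)%:R * y j i)).
rewrite -[\prod_j _]/(\prod_j B j).
have az N j : abs (1 - xi j ^+ (p ^ N)) = 1.
  by apply: (@pabs_one_sub_root c) => //; exact: nontriv_roots_exp.
have GN j : fps_tends_to (G^~ j) 1.
  move=> m; have [->|m0] := eqVneq m 0.
    apply: (@tends_to_near (fun=> 1)); last by rewrite fps_one0; exact: tends_to_cst.
    (* At [N = 0] the constant term is (1 - eta_j) / (1 - xi_j), which may differ from 1. *)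
    exists 1%N => // -[//|N] _; rewrite /G fps_constM fps_subE fps_constM exp_series_at0.
    by rewrite fps_one0 mulr1 etaX mulVf// -pabs_eq0 az oner_eq0.
  have -> : (1 : fps C r) m = 0 by rewrite [LHS]/(_%:R) (negbTE m0).
  (* In positive degree only the exponential contributes, scaled by factors of absolute value 1. *)
  apply: (@tends_to_bound (fun N => abs (exp_series (fun i => (p ^ N)%:R * y j i) m - 0))).
    move=> N; rewrite !subr0 /G fps_constM fps_subE fps_constM.
    have -> : (1 : fps C r) m = 0 by rewrite [LHS]/(_%:R) (negbTE m0).
    rewrite sub0r pabsM pabsV// az invr1 mul1r pabsN pabsM pabsX.
    by rewrite aeta expr1n mul1r.
  exact: tends_to_exp_expp.
apply: (@tends_to_near (fun N =>
  (\prod_j (k j)`!)%N%:R * (\prod_j (B j * G N j)) [ffun j => k j])).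
  apply: nearW => N; rewrite (eq_bigr (fun j => fps_const (1 - xi j ^+ (p ^ N))^-1 *
    (B j * (1 - fps_const (eta j ^+ (p ^ N)) *
       exp_series (fun i => (p ^ N)%:R * y j i))))); last first.
    by move=> j _; rewrite /G mulrCA.
  rewrite big_split /= -fps_const_prod fps_constM -geometric_exp_series// !big_distrr.
  apply: eq_bigr => a _; rewrite exp_series_ffun big_split /= natr_prod.
  have : \prod_i (k i)`!%:R != 0 :> C.
    by apply/prodf_neq0 => i _; rewrite padic_natr_eq0// -lt0n fact_gt0.
  move: (\prod_i (k i)`!%:R) => K K0.
  by rewrite mulrCA (mulrCA K) (mulrC K) divfK// mulrA mulrC [X in _ * X = _]mulrC.
apply: tends_toM; first exact: tends_to_cst.
have BG : fps_tends_to (fun N => \prod_j (B j * G N j)) (\prod_j B j).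
  rewrite (eq_bigr (fun j => B j * 1)) => [|j _]; last by rewrite mulr1.
  apply: fps_tends_to_prod => j; apply: fps_tends_toM => // m; exact: tends_to_cst.
exact: BG.
Qed.

End PadicLimits.

(** * Expansion of the indicator function of the domain *)

Section IncreasingMaps.
Variable r : nat.

(** Same boolean formula as the condition on [i] in the theorem, so the two sums agree by
    conversion. *)
Definition increasing d (i : {ffun 'I_d -> 'I_r}) :=
  [forall l : 'I_d, forall l' : 'I_d, (l < l')%N ==> (i l < i l')%N].

Lemma increasingP d (i : {ffun 'I_d -> 'I_r}) :
  reflect {homo i : l l' / (l < l')%N} (increasing i).
Proof.
apply: (iffP forallP) => [h l l'|h l]; first by have /forallP/(_ l')/implyP := h l.
by apply/forallP => l'; apply/implyP/h.
Qed.

Lemma enum_set_ltn_sorted (A : {set 'I_r}) : sorted ltn (map val (enum A)).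
Proof.
rewrite -[enum _](eq_filter (mem_enum _)) -(eq_filter (mem_map val_inj _)) -filter_map.
by rewrite (sorted_filter ltn_trans)// -enumT val_enum_ord iota_ltn_sorted.
Qed.

(** Both lists are strictly sorted with the same members, which determines them. *)
Lemma increasing_enum_imset d (i : {ffun 'I_d -> 'I_r}) :
  increasing i -> enum [set i l | l : 'I_d] = map i (enum 'I_d).
Proof.
move=> /increasingP i_incr; apply: (inj_map val_inj).
apply: (irr_sorted_eq ltn_trans ltnn); first exact: enum_set_ltn_sorted.
  rewrite -map_comp; apply: (@homo_sorted _ _ (val \o i) (relpre val ltn)).
    by move=> l l' /=; apply: i_incr.
  by rewrite -sorted_map val_enum_ord iota_ltn_sorted.
move=> x; apply/mapP/mapP => -[k].
  by rewrite mem_enum => /imsetP[l _ ->] ->; exists (i l) => //; rewrite map_f ?mem_enum.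
by case/mapP => l _ -> ->; exists (i l) => //; rewrite mem_enum imset_f.
Qed.

(** A set of size [d] corresponds to its increasing enumeration by ['I_d]; positivity of [r]
    supplies the default element of [nth]. *)
Lemma sum_subsets_increasing (V : nmodType) (F : {set 'I_r} -> V) : (0 < r)%N ->
  \sum_(A : {set 'I_r}) F A =
  \sum_(0 <= d < r.+1) \sum_(i : {ffun 'I_d -> 'I_r} | increasing i) F [set i l | l : 'I_d].
Proof.
move=> r_gt0; pose i0 := Ordinal r_gt0.
have cardA (A : {set 'I_r}) : (#|A| <= r)%N by rewrite -[leqRHS]card_ord max_card.
rewrite (partition_big (fun A : {set 'I_r} => inord #|A| : 'I_r.+1) xpredT)//= big_mkord.
apply: eq_bigr => -[d dr] _ /=.
rewrite (eq_bigl (fun A : {set 'I_r} => #|A| == d)); last first.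
  by move=> A; rewrite -val_eqE /= inordK// ltnS.
rewrite (reindex_onto (fun i : {ffun 'I_d -> 'I_r} => [set i l | l : 'I_d])
  (fun A => [ffun l : 'I_d => nth i0 (enum A) l])) => [|A /eqP Ad]; last first.
  apply/setP => k; apply/imsetP/idP => [[l _ ->]|kA].
    by rewrite ffunE -mem_enum mem_nth// -cardE Ad.
  have kd : (index k (enum A) < d)%N by rewrite -Ad cardE index_mem mem_enum.
  by exists (Ordinal kd) => //; rewrite ffunE nth_index// mem_enum.
(* The side condition of the reindexing, that the image has [d] elements and enumerates back to [i],
   amounts to [i] being increasing. *)
apply: eq_bigl => i; apply/andP/idP => [[/eqP id_ /eqP iE]|i_incr].
  apply/increasingP => l l' ll'; rewrite -iE !ffunE.
  have sz : size (map val (enum [set i l | l : 'I_d])) = d by rewrite size_map -cardE.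
  have := @sorted_ltn_nth _ ltn ltn_trans 0%N _ (enum_set_ltn_sorted [set i l | l : 'I_d]) l l'.
  rewrite !inE sz !ltn_ord => /(_ isT isT ll').
  by rewrite !(nth_map i0) -?cardE ?id_.
have e := increasing_enum_imset i_incr; split; first by rewrite cardE e size_map size_enum_ord.
apply/eqP/ffunP => l; rewrite ffunE e (nth_map l) ?size_enum_ord//.
by congr (i _); apply: val_inj; rewrite /= nth_enum_ord.
Qed.

Lemma increasing_inj d (i : {ffun 'I_d -> 'I_r}) : increasing i -> injective i.
Proof.
move=> /increasingP i_incr l l' e; apply: val_inj.
by case: (ltngtP l l') => // /i_incr; rewrite e ltnn.
Qed.

Lemma prodr_1D_increasing (A : comPzRingType) (g : 'I_r -> A) : (0 < r)%N ->
  \prod_k (1 + g k) =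
  \sum_(0 <= d < r.+1) \sum_(i : {ffun 'I_d -> 'I_r} | increasing i) \prod_l g (i l).
Proof.
move=> r_gt0; under eq_bigr do rewrite addrC.
rewrite bigA_distr (eq_bigr (fun J : {set 'I_r} => \prod_(k in J) g k)) => [|J _]; last first.
  by rewrite [RHS]big_mkcond.
rewrite sum_subsets_increasing//; apply: eq_bigr => d _; apply: eq_bigr => i /increasing_inj i_inj.
by rewrite big_imset//; move=> l l' _ _; exact: i_inj.
Qed.

End IncreasingMaps.

(** * The integrand, the indicator function and the measure at integer points *)

Section Integrand.
Context {R : realType} {p : nat} {C : padicComplexType R p}.
Hypothesis p_prime : prime p.
Local Notation abs := (@pabs R p C).

Lemma gbinom_nat n m : gbinom (n%:R : C) m = 'C(n, m)%:R.
Proof.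
have m0 : m`!%:R != 0 :> C by rewrite padic_natr_eq0// -lt0n fact_gt0.
apply: (mulIf m0); rewrite divfK// -natrM bin_ffact; case: (leqP m n) => mn.
  rewrite ffact_prod natr_prod; apply: eq_bigr => i _.
  by rewrite natrB// (leq_trans (ltnW (ltn_ord i))).
by rewrite ffact_small// (bigD1 (Ordinal mn))//= subrr mul0r.
Qed.

(** The binomial series is finite: its partial sums are constant from [n + 1] terms on. *)
Lemma diamond_pow_nat (y : C) n : diamond_pow y n%:R = diamond y ^+ n.
Proof.
apply: plimE => //; apply: (@tends_to_near _ _ _ (fun=> diamond y ^+ n)); last first.
  exact: tends_to_cst.
exists n.+1 => // N /= nN; rewrite (big_cat_nat (leq0n n.+1) nN)/= [X in _ + X]big1_seq ?addr0.
  rewrite big_mkord -{1}[diamond y](subrK 1) addrC exprDn; apply: eq_bigr => m _.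
  by rewrite expr1n mul1r gbinom_nat mulr_natl.
move=> m; rewrite mem_index_iota => /andP[_ /andP[nm _]].
by rewrite gbinom_nat bin_small// mul0r.
Qed.

(** Holds for every [y], units or not, thanks to the default value 1 in [teichmuller]. *)
Lemma teichmuller_neq0 (y : C) : teichmuller y != 0.
Proof.
rewrite /teichmuller; case: xgetP => [w _ [+ _]|_]; last exact: oner_neq0.
rewrite /padic_W; case: ifP => _; last by case=> -[].
by case=> ->; rewrite ?oppr_eq0 oner_eq0.
Qed.

(** The powers of the Teichmüller factor cancel. The double negation comes from evaluating [padicL]
    at [s = - n]; since [y] is arbitrary, the integrand becomes polynomial off the domain as
    well. *)
Lemma diamond_pow_teichmuller (y : C) n :
  diamond_pow y (- - n%:R) * teichmuller y ^ n%:Z = y ^+ n.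
Proof.
by rewrite opprK diamond_pow_nat -exprnP -exprMn divfK// teichmuller_neq0.
Qed.

Lemma exprz_prod (I : Type) (s : seq I) (P : pred I) (F : I -> C) (m : int) :
  (\prod_(i <- s | P i) F i) ^ m = \prod_(i <- s | P i) F i ^ m.
Proof. by apply: (big_morph (fun x => x ^ m)) => [x y|]; [exact: expfzMl|exact: exp1rz]. Qed.

Lemma exprz_sum (I : Type) (s : seq I) (P : pred I) (x : C) (m : I -> int) : x != 0 ->
  x ^ (\sum_(i <- s | P i) m i) = \prod_(i <- s | P i) x ^ m i.
Proof. by move=> x0; apply: (big_morph (fun m => x ^ m)) => [a b|]; [exact: expfzDr|]. Qed.

(** Each condition on a partial sum is detected by a sum over the p-th roots of unity [w ^+ e]; the
    product of these detectors is expanded over increasing maps, then over the choices of roots. *)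
Lemma indic_domain_expansion r (gamma : 'I_r -> C) (w : C) (a : 'I_r -> nat) :
  (0 < r)%N -> (forall j, padic_int (gamma j)) -> p.-primitive_root w ->
  \1_(padicL_domain gamma) (fun j => (a j)%:R) =
  \sum_(0 <= d < r.+1) (- (p%:R^-1)) ^+ d *
    \sum_(i : {ffun 'I_d -> 'I_r} | increasing i) \sum_(e : {ffun 'I_d -> 'I_p})
      \prod_(j < r) padic_root_pow (\prod_(l < d | (j <= i l)%N) w ^+ e l) (gamma j) ^+ a j :> C.
Proof.
move=> r_gt0 gammaZ wp; have w0 : w != 0.
  apply: contra_eq_neq (prim_expr_order wp) => ->.
  by rewrite expr0n gtn_eqF ?prime_gt0// eq_sym oner_eq0.
pose m (k : 'I_r) := \sum_(j < r | (j <= k)%N) (a j)%:Z * residue (gamma j).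
have mP k : padic_congr p (partial_lin (fun j => (a j)%:R) gamma k) 0 <-> (p %| m k)%Z.
  exact: padic_congr_lin_residue.
(* By orthogonality the factor at [k] is 0 if [p] divides [m k] and 1 otherwise. *)
transitivity (\prod_k (1 + - (p%:R^-1) * \sum_(e < p) (w ^+ e) ^ m k) : C).
  have factor k : 1 + - (p%:R^-1) * \sum_(e < p) (w ^+ e) ^ m k = (~~ (p %| m k)%Z)%:R :> C.
    rewrite sum_prim_root_expz//; case: ifP => _ /=; last by rewrite mulr0 addr0.
    by rewrite mulNr mulVf ?subrr// padic_natr_eq0// -lt0n prime_gt0.
  under eq_bigr do rewrite factor; rewrite indicE.
  have [/forallP nd|/forallPn[k]] := boolP [forall k, ~~ (p %| m k)%Z].
    rewrite mem_set; first by rewrite big1// => k _; rewrite nd.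
    split=> [j|k]; first by have := padic_int_intr p_prime (C := C) (a j).
    by move/mP; apply/negP.
  rewrite negbK => dk; rewrite memNset; first by rewrite (bigD1 k)//= dk mul0r.
  by case=> _ /(_ k); apply; apply/mP.
rewrite prodr_1D_increasing//; apply: eq_bigr => d _; rewrite big_distrr.
apply: eq_bigr => i _ /=; rewrite big_split prodr_const card_ord; congr (_ * _).
rewrite bigA_distr_bigA; apply: eq_bigr => e _.
have wX0 l : w ^+ l != 0 by rewrite expf_neq0.
transitivity (\prod_(l < d) \prod_(j < r | (j <= i l)%N) ((w ^+ e l) ^ residue (gamma j)) ^+ a j).
  apply: eq_bigr => l _; rewrite exprz_sum//; apply: eq_bigr => j _.
  by rewrite mulrC -exprz_exp exprnP.
(* For fixed [j] this collects the roots chosen at all [l] with [j <= i l], all raised to the same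
   exponent. *)
rewrite (exchange_big_dep xpredT)//=; apply: eq_bigr => j _.
by rewrite prodrXl /padic_root_pow -/(residue _) exprz_prod.
Qed.

Lemma prod_mtilde r c m (v : 'I_m -> C) N (a : 'I_r -> nat) :
  injective v -> (forall x, nontriv_roots c x <-> exists i, v i = x) ->
  \prod_j padic_mtilde (C := C) c N (a j) =
  \sum_(x : {ffun 'I_r -> 'I_m}) \prod_j (v (x j) ^+ a j / (1 - v (x j) ^+ (p ^ N))).
Proof.
move=> v_inj vP; rewrite -(bigA_distr_bigA (fun j x => v x ^+ a j / (1 - v x ^+ (p ^ N)))).
apply: eq_bigr => j _; apply: (@fsbig_injective _ _ _ xpredT) => // x.
by rewrite vP; split=> [[i <-]|[i _ <-]]; exists i.
Qed.

(** The index type consists of the positions in the list of roots of X^c - 1, with repetitions and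
    the root 1 removed. *)
Lemma nontriv_roots_enum c : (0 < c)%N ->
  exists m (v : 'I_m -> C), injective v /\ (forall x, nontriv_roots c x <-> exists i, v i = x).
Proof.
move=> c0; have [s sE] := closed_field_poly_normal ('X^c - 1 : {poly C}).
have sP x : x ^+ c = 1 <-> x \in s.
  rewrite -root_prod_XsubC.
  have -> : \prod_(z <- s) ('X - z%:P) = 'X^c - 1.
    by rewrite sE (monicP _) ?scale1r// -polyC1 monicXnsubC.
  rewrite /root hornerD hornerXn hornerN hornerC subr_eq0.
  by split=> /eqP.
pose t := [seq x <- undup s | x != 1].
exists (size t), (fun i => nth 0 t i); split=> [i j /eqP|x].
  by rewrite nth_uniq ?filter_uniq ?undup_uniq// => /eqP/val_inj.
have tP : nontriv_roots c x <-> x \in t.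
  by rewrite mem_filter mem_undup; split=> [[/sP -> ->]//|/andP[x1 /sP xc]].
rewrite tP; split=> [/(nthP 0)[i it <-]|[i <-]]; last exact: mem_nth.
by exists (Ordinal it).
Qed.

(** There is a single map from the empty type; this collapses the sums in the term [d = 0]. *)
Lemma big_ffun_ord0 (V : nmodType) (T : finType) (P : pred {ffun 'I_0 -> T})
    (F : {ffun 'I_0 -> T} -> V) (x : {ffun 'I_0 -> T}) :
  P x -> \sum_(i | P i) F i = F x.
Proof.
move=> Px; rewrite (big_pred1 x)// => i /=.
have -> : i = x by apply/ffunP => -[].
by rewrite eqxx Px.
Qed.

End Integrand.

(** * Evaluation of the multiple L-function at nonpositive integers *)

Theorem theorem2p1 (R : realType) (p : nat) (p_prime : prime p)
    (C : padicComplexType R p) (r : nat) (r_gt0 : (0 < r)%N)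
    (n : 'I_r -> nat) (gamma : 'I_r -> C) (gamma_int : forall j, padic_int (gamma j))
    (c : nat) (c_gt1 : (1 < c)%N) (cp_coprime : coprime c p) :
  padicL (fun j => - (n j)%:R) (fun j => (n j)%:Z) gamma c =
  \sum_(xi \in [set xi : {ffun 'I_r -> C} | forall j, nontriv_roots c (xi j)])
     twisted_bernoulli n xi gamma
  + \sum_(1 <= d < r.+1) (- (p%:R^-1)) ^+ d *
      \sum_(i : {ffun 'I_d -> 'I_r} |
             [forall l : 'I_d, forall l' : 'I_d, (l < l')%N ==> (i l < i l')%N])
      \sum_(rho \in [set rho : {ffun 'I_d -> C} | forall l, rho l ^+ p = 1])
      \sum_(xi \in [set xi : {ffun 'I_r -> C} | forall j, nontriv_roots c (xi j)])
        twisted_bernoulli n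
          (fun j => padic_root_pow (\prod_(l < d | (j <= i l)%N) rho l) (gamma j)
                    * xi j)
          gamma.
Proof.
have c_gt0 : (0 < c)%N by exact: ltnW.
have [w wp] := padic_prim_root p_prime (C := C).
have [m [v [v_inj vP]]] := @nontriv_roots_enum R p C c c_gt0.
have w_inj : injective (fun i : 'I_p => w ^+ i).
  by move=> i j /eqP; rewrite (eq_prim_root_expr wp) !modn_small// => /eqP/val_inj.
have wP (x : C) : x ^+ p = 1 <-> exists i : 'I_p, w ^+ i = x.
  split=> [/(prim_rootP wp)[i ->]|[i <-]]; first by exists i.
  by rewrite exprAC (prim_expr_order wp) expr1n.
pose eta d (i : {ffun 'I_d -> 'I_r}) (e : {ffun 'I_d -> 'I_p})
    (x : {ffun 'I_r -> 'I_m}) (j : 'I_r) :=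
  padic_root_pow (\prod_(l < d | (j <= i l)%N) w ^+ e l) (gamma j) * v (x j).
(* The twisting factor is an integer power of a product of p-th roots of unity, hence itself a p-th
   root of unity. *)
have etap d i e x j : @eta d i e x j ^+ p = v (x j) ^+ p.
  rewrite /eta exprMn /padic_root_pow exprnP exprzAC -exprnP -prodrXl.
  rewrite big1 ?exp1rz ?mul1r// => l _.
  by rewrite exprAC (prim_expr_order wp) expr1n.
have tbE z z' : z =1 z' ->
  twisted_bernoulli n z gamma = twisted_bernoulli n z' gamma by move=> /funext ->.
(* The untwisted sum is absorbed as the term [d = 0], and all roots of unity are indexed by finite
   types. *)
transitivity (\sum_(0 <= d < r.+1) (- (p%:R^-1)) ^+ d *
    \sum_(i : {ffun 'I_d -> 'I_r} | increasing i) \sum_(e : {ffun 'I_d -> 'I_p})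
      \sum_(x : {ffun 'I_r -> 'I_m}) twisted_bernoulli n (eta d i e x) gamma); last first.
  have xiE F : \sum_(xi \in [set xi : {ffun 'I_r -> C} | forall j, nontriv_roots c (xi j)]) F xi
      = \sum_(x : {ffun 'I_r -> 'I_m}) F [ffun j => v (x j)] :> C.
    exact: fsbig_ffun.
  rewrite big_ltn// expr0 mul1r; congr (_ + _).
    rewrite (big_ffun_ord0 _ (x := ffun0 (card_ord 0))); last by apply/increasingP => -[].
    rewrite (big_ffun_ord0 _ (x := ffun0 (card_ord 0)))//.
    rewrite [RHS]xiE.
    apply: eq_bigr => x _.
    apply: tbE => j.
    by rewrite /eta big_ord0 /padic_root_pow exp1rz mul1r ffunE.
  apply: eq_bigr => d _; congr (_ * _); apply: eq_bigr => i _.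
  rewrite (fsbig_ffun _ w_inj wP); apply: eq_bigr => e _.
  rewrite [RHS]xiE; apply: eq_bigr => x _; apply: tbE => j.
  rewrite ffunE; congr (padic_root_pow _ _ * _).
  by apply: eq_bigr => l _; rewrite ffunE.
apply: plimE => //.
(* The share of the N-th Riemann sum belonging to one choice of indices and roots; it tends to the
   corresponding twisted Bernoulli number. *)
pose S N d i e x := \sum_(a : {ffun 'I_r -> 'I_(p ^ N)})
      (\prod_(k < r) (\sum_(j < r | (j <= k)%N) (a j)%:R * gamma j) ^+ n k) *
      \prod_j (@eta d i e x j ^+ a j / (1 - v (x j) ^+ (p ^ N))).
apply: (@tends_to_near _ _ _ (fun N => \sum_(0 <= d < r.+1) (- (p%:R^-1)) ^+ d *
    \sum_(i : {ffun 'I_d -> 'I_r} | increasing i) \sum_(e : {ffun 'I_d -> 'I_p})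
      \sum_(x : {ffun 'I_r -> 'I_m}) S N d i e x)); last first.
  apply: tends_to_sum => d; apply: tends_toM; first exact: tends_to_cst.
  apply: tends_to_sum => i; apply: tends_to_sum => e; apply: tends_to_sum => x.
  by apply: (@tends_to_twisted_bernoulli R p C p_prime r c) => // j; apply/vP; exists (x j).
apply: nearW => N; apply: esym.
(* For every [N] the Riemann sum equals the combination of the [S N d i e x] exactly: indicator and
   measure are expanded at each point [a], and the sum over [a] is then moved innermost. *)
under eq_bigr => a _.
  rewrite (indic_domain_expansion p_prime _ r_gt0 gamma_int wp).
  rewrite (eq_bigr (fun k => partial_lin (fun j => (a j)%:R) gamma k ^+ n k)); last first.
    by move=> k _; exact: diamond_pow_teichmuller.
  rewrite (prod_mtilde N _ v_inj vP).
  rewrite -mulrA big_distrl /=.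
  over.
rewrite exchange_big /=; apply: eq_bigr => d _.
under eq_bigr do rewrite -mulrA big_distrl /=.
rewrite -big_distrr /=; congr (_ * _).
rewrite exchange_big /=; apply: eq_bigr => i _.
under eq_bigr do rewrite big_distrl /=.
rewrite exchange_big /=; apply: eq_bigr => e _.
under eq_bigr do rewrite mulrCA !big_distrr /=.
rewrite exchange_big /=; apply: eq_bigr => x _; apply: eq_bigr => a _.
congr (_ * _); rewrite -big_split; apply: eq_bigr => j _ /=.
by rewrite mulrA -exprMn.
Qed.
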